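(* Let $A$ be a complete commutative local ring with maximal ideal $\mathfrak r$, in which $2$ is a unit, with a ramified involution $*$. Let $V$ be a free $A$-module of finite rank $m>0$ and let $h:V\times V\to A$ be a nondegenerate skew hermitian form. Then $V$ has a symplectic basis with respect to $h$.
   Context: An involution of $A$ is a ring automorphism $a\mapsto a^*$ of order at most two (the identity is allowed). It is ramified if $\{a\in A:a^*=-a\}\subset\mathfrak r$ (equivalently, the induced involution on $A/\mathfrak r$ is trivial). Complete means that $\bigcap_{i\ge1}\mathfrak r^i=0$ and $A$ is complete for its $\mathfrak r$-adic metric. A map $h:V\times V\to A$ is a skew hermitian form if it is bi-additive, $A$-linear in the second variable, and $h(v,u)=-h(u,v)^*$ for all $u,v$. It is nondegenerate if the Gram matrix $(h(v_i,v_j))$ of any basis of $V$ is invertible over $A$. A symplectic pair is a pair $(u,v)\in V^2$ with $h(u,u)=h(v,v)=0$ and $h(u,v)=-h(v,u)=1$. A symplectic basis is a basis $v_1,w_1,\dots,v_l,w_l$ of $V$ such that each $(v_i,w_i)$ is a symplectic pair and $h(v_i,v_j)=h(w_i,w_j)=h(v_i,w_j)=h(w_j,v_i)=0$ for $i\ne j$. *)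

(* Defs.v *)
From mathcomp Require Import all_boot all_algebra.
From mathcomp Require Import classical_sets.

Set Implicit Arguments.
Unset Strict Implicit.
Unset Printing Implicit Defensive.

Import GRing.Theory.

Local Open Scope classical_set_scope.
Local Open Scope ring_scope.

Section Ideals.
Variable A : comUnitRingType.
Implicit Types I J : set A.

(* [idealr_closed] includes properness (1 is not in the ideal). *)
Definition proper_ideal_set I : Prop := idealr_closed [in I].

Definition maximal_ideal I : Prop :=
  proper_ideal_set I /\ forall J, proper_ideal_set J -> I `<=` J -> J = I.

Definition local_with_maximal I : Prop :=
  maximal_ideal I /\ forall J, maximal_ideal J -> J = I.

Definition ideal_mul I J : set A :=
  [set x | exists n (a b : 'I_n -> A),
     [/\ forall k, I (a k), forall k, J (b k) & x = \sum_k a k * b k]].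

Definition ideal_exp I (i : nat) : set A := iter i (ideal_mul I) setT.

(* The balls of the I-adic metric are the cosets of the powers of I, so the
   two definitions below are the Cauchy property and convergence for it. *)
Definition adic_cauchy I (u : nat -> A) : Prop :=
  forall i, exists N, forall p q, (N <= p)%N -> (N <= q)%N ->
    ideal_exp I i (u p - u q).

Definition adic_cvg I (u : nat -> A) (x : A) : Prop :=
  forall i, exists N, forall p, (N <= p)%N -> ideal_exp I i (u p - x).

Definition adic_complete I : Prop :=
  \bigcap_(i in [set i | (1 <= i)%N]) ideal_exp I i = [set 0] /\
  forall u, adic_cauchy I u -> exists x, adic_cvg I u x.

Definition ramified I (star : A -> A) : Prop := [set a | star a = - a] `<=` I.

End Ideals.

Section Forms.
Variables (A : comUnitRingType) (V : lmodType A).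

Definition is_basis (K : finType) (e : K -> V) : Prop :=
  (forall x, exists c : K -> A, x = \sum_k c k *: e k) /\
  (forall c : K -> A, \sum_k c k *: e k = 0 -> forall k, c k = 0).

Definition free_of_rank (m : nat) : Prop := exists e : 'I_m -> V, is_basis e.

(* Linear in the second variable, unlike the library's Hermitian forms, which
   are linear in the first. *)
Definition skew_hermitian_form (star : A -> A) (h : V -> V -> A) : Prop :=
  [/\ forall u u' v, h (u + u') v = h u v + h u' v,
      forall u v v', h u (v + v') = h u v + h u v',
      forall a u v, h u (a *: v) = a * h u v
    & forall u v, h v u = - star (h u v)].

Definition gram (h : V -> V -> A) n (e : 'I_n -> V) : 'M[A]_n :=
  \matrix_(i, j) h (e i) (e j).

Definition nondegenerate_form (h : V -> V -> A) : Prop :=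
  forall n (e : 'I_n -> V), is_basis e -> gram h e \in unitmx.

Definition symplectic_pair (h : V -> V -> A) (u v : V) : Prop :=
  [/\ h u u = 0, h v v = 0, h u v = 1 & - h v u = 1].

(* The vectors v_1, w_1, ..., v_l, w_l are indexed by the disjoint sum
   'I_l + 'I_l. *)
Definition symplectic_basis (h : V -> V -> A) l (v w : 'I_l -> V) : Prop :=
  [/\ is_basis (fun k : 'I_l + 'I_l =>
                  match k with inl i => v i | inr i => w i end),
      forall i, symplectic_pair h (v i) (w i)
    & forall i j, i != j ->
        [/\ h (v i) (v j) = 0, h (w i) (w j) = 0,
            h (v i) (w j) = 0 & h (w j) (v i) = 0]].

End Forms.

(* Main.v *)
(* Elements outside r are units and h(x, x) lies in r, so nondegeneracy provides
   for any basis vector u some v with h(u, v) = 1.  A skew fixed point s of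
   s |-> (b s^2 - a) / 2, where a = h(u, u) and b = h(v, v), makes u + s v
   isotropic; it exists because the map is a contraction.  After correcting
   v too, one splits off the plane and recurses on its orthogonal complement.
   The recursion keeps nondegeneracy in the form "if h(e_k, sum_l c_l e_l) lies
   in r for all k, then every c_l lies in r", which passes to the complement
   without any determinant; linear independence of the final family follows
   from the symplectic relations. *)

Require Import Defs.
From mathcomp Require Import all_boot all_algebra.
From mathcomp Require Import classical_sets.
From mathcomp Require Import boolp ring.

Set Implicit Arguments.
Unset Strict Implicit.
Unset Printing Implicit Defensive.

Import GRing.Theory.

Local Open Scope ring_scope.

(** * Powers of an ideal *)

Section IdealPowers.
Variables (A : comUnitRingType) (r : set A).

Lemma ideal_mul_add (I J : set A) x y :
  ideal_mul I J x -> ideal_mul I J y -> ideal_mul I J (x + y).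
Proof.
move=> [n [a [b [Ia Jb ->]]]] [n' [a' [b' [Ia' Jb' ->]]]].
exists (n + n')%N.
exists (fun k => match split k with inl i => a i | inr i => a' i end).
exists (fun k => match split k with inl i => b i | inr i => b' i end).
split=> [k|k|]; try by case: (split k).
rewrite big_split_ord /=; congr (_ + _); apply: eq_bigr => i _.
  by rewrite (unsplitK (inl i)).
by rewrite (unsplitK (inr i)).
Qed.

Lemma ideal_exp_add i x y :
  ideal_exp r i x -> ideal_exp r i y -> ideal_exp r i (x + y).
Proof. by case: i => // i; apply: ideal_mul_add. Qed.

Lemma ideal_exp_mulS i x y :
  r x -> ideal_exp r i y -> ideal_exp r i.+1 (x * y).
Proof.
by move=> rx ry; exists 1%N, (fun=> x), (fun=> y); split; rewrite ?big_ord1.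
Qed.

Lemma ideal_exp_mull i a x : ideal_exp r i x -> ideal_exp r i (a * x).
Proof.
elim: i a x => [//|i IHi] a _ [n [b [c [rb rc ->]]]].
exists n, b, (fun k => a * c k); split=> // [k|]; first by apply/IHi/rc.
by rewrite mulr_sumr; apply: eq_bigr => k _; rewrite mulrCA.
Qed.

Lemma ideal_exp_sub i x y :
  ideal_exp r i x -> ideal_exp r i y -> ideal_exp r i (x - y).
Proof.
by move=> rx ry; apply: ideal_exp_add => //; rewrite -mulN1r;
   apply: ideal_exp_mull.
Qed.

End IdealPowers.

(** * Complete local rings: fixed points, units and a quadratic equation *)

Section CompleteLocal.
Variables (A : comUnitRingType) (r : set A).
Hypothesis r_local : local_with_maximal r.

Lemma maximal0 : r 0.
Proof. by case: r_local => [[[+ _ _] _] _]; rewrite inE. Qed.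

Lemma maximal1 : ~ r 1.
Proof. by case: r_local => [[[_ + _] _] _] => /negP r1 r1'; apply: r1; rewrite inE. Qed.

Lemma maximalMD a x y : r x -> r y -> r (a * x + y).
Proof.
case: r_local => [[[_ _ rD] _] _] rx ry.
by have := rD a x y; rewrite !inE; apply.
Qed.

Lemma maximalD x y : r x -> r y -> r (x + y).
Proof. by rewrite -{2}[x]mul1r; apply: maximalMD. Qed.

Lemma maximalM a x : r x -> r (a * x).
Proof. by move=> rx; rewrite -[_ * _]addr0; apply: maximalMD => //; apply: maximal0. Qed.

Lemma maximalMr a x : r x -> r (x * a).
Proof. by rewrite mulrC; apply: maximalM. Qed.

Lemma maximalN x : r x -> r (- x).
Proof. by rewrite -mulN1r; apply: maximalM. Qed.

Lemma maximal_sum (K : finType) (P : pred K) (F : K -> A) :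
  (forall k, P k -> r (F k)) -> r (\sum_(k | P k) F k).
Proof. by move=> rF; elim/big_ind: _ => //; [apply: maximal0 | apply: maximalD]. Qed.

Lemma ideal_exp1 x : ideal_exp r 1 x -> r x.
Proof.
by move=> [n [a [b [ra _ ->]]]]; apply: maximal_sum => k _; apply: maximalMr.
Qed.

(** The element [x - star x] is skew, hence in [r], and subtracting it from [x] gives [star x]. *)
Lemma ramified_maximal (star : {rmorphism A -> A}) x :
  involutive star -> ramified r star -> r x -> r (star x).
Proof.
move=> starK ram rx; rewrite -[star x](subKr x); apply: maximalD => //.
by apply: maximalN; apply: ram; rewrite /= rmorphB starK opprB.
Qed.

Hypothesis r_complete : adic_complete r.

(** Banach's argument in the [r]-adic metric: each application of [f] gains one power of [r], so the
    iterates starting at 0 converge, and the limit is fixed because the powers of [r] meet in 0. *)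
Lemma contraction_fixpoint (f : A -> A) :
  (forall x, r x -> r (f x)) ->
  (forall x y, r x -> r y -> exists2 q, r q & f x - f y = q * (x - y)) ->
  exists2 s, r s & f s = s.
Proof.
move=> rf f_contr; case: r_complete => r_sep r_lim.
pose u n := iter n f 0.
have ru n : r (u n) by elim: n => [|n IHn]; [apply: maximal0 | apply: rf].
have du i p : (i <= p)%N -> ideal_exp r i (u p - u i).
  elim: i p => // i IHi [|p] // le_ip.
  have [q rq] := f_contr _ _ (ru p) (ru i).
  by rewrite /u /= => ->; apply: ideal_exp_mulS => //; apply: IHi.
have [|s us] := r_lim u.
  move=> i; exists i => p q le_ip le_iq.
  rewrite -[u p - u q](subrKA (u i)) -(opprB (u q)).
  by apply: ideal_exp_sub; apply: du.
have rs : r s.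
  have [p /(_ p (leqnn p))/ideal_exp1 rps] := us 1%N.
  by rewrite -[s](subKr (u p)); apply: maximalD => //; apply: maximalN.
exists s => //; apply/eqP; rewrite -subr_eq0; apply/eqP.
suff: [set 0 : A]%classic (f s - s) by [].
rewrite -r_sep => i _; have [p up] := us i.
(* Split [f s - s] as [f s - f (u p)] plus [u p.+1 - s]; both are small once [u p] is close to
   [s]. *)
rewrite -[f s - s](subrKA (f (u p))); apply: ideal_exp_add; last first.
  exact: (up p.+1 (leqnSn p)).
have [q _ ->] := f_contr _ _ rs (ru p).
rewrite -(opprB (u p)) mulrN -mulNr.
by apply: ideal_exp_mull; apply: up.
Qed.

(** The geometric series as a fixed point: if [s = x * s + x], then [1 + s] is inverse to
    [1 - x]. *)
Lemma unit_sub1 x : r x -> 1 - x \is a GRing.unit.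
Proof.
move=> rx; have [|y z _ _|s rs /= s_fix] := contraction_fixpoint (f := fun y => x * y + x).
- by move=> y ry; rewrite mulrC; apply: maximalMD.
- by exists x => //; ring.
apply/unitrPr; exists (1 + s).
by rewrite mulrDr mulr1 mulrBl mul1r -{1}s_fix; ring.
Qed.

(** Either the ideal [r + A a] contains 1, and then a multiple of [a] has the form [1 - b] with [b]
    in [r], or it is proper, so it equals [r] by maximality and contains [a]. *)
Lemma unit_notin_maximal a : ~ r a -> a \is a GRing.unit.
Proof.
move=> nra; pose J : set A := [set x | exists2 b, r b & exists c, x = b + c * a]%classic.
have [[b rb [c cE]]|nJ1] := pselect (J 1).
  have: c * a \is a GRing.unit.
    have -> : c * a = 1 - b by rewrite cE; ring.
    exact: unit_sub1.
  by rewrite unitrM => /andP[].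
case: r_local => [[_ r_max] _].
have rJ : J = r.
  apply: r_max => [|x rx]; last by exists x => //; exists 0; ring.
  split; rewrite ?inE.
  - by exists 0; [apply: maximal0 | exists 0; ring].
  - by apply/negP; rewrite inE.
  move=> d x y; rewrite !inE => -[b rb [c ->]] [b' rb' [c' ->]].
  by exists (d * b + b'); [apply: maximalMD | exists (d * c + c'); ring].
case: nra; rewrite -rJ; exists 0; [exact: maximal0 | by exists 1; ring].
Qed.

(** For [a = h u u], [b = h v v], [h u v = 1] and skew [s], the left side is the value of [h] at
    [u + s v] paired with itself. The contraction factor [(x + y) / 2 * b] lies in [r] because [b]
    does. *)
Lemma skew_quadratic_root (star : {rmorphism A -> A}) a b :
  (2%:R : A) \is a GRing.unit -> involutive star -> ramified r star ->
  star a = - a -> star b = - b ->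
  exists2 s, star s = - s & a + 2%:R * s - s ^+ 2 * b = 0.
Proof.
move=> U2 starK ram skew_a skew_b.
have [ra rb] : r a /\ r b by split; apply: ram.
have [||s rs /= s_fix] := contraction_fixpoint (f := fun s => (s ^+ 2 * b - a) / 2%:R).
- by move=> x _; apply: maximalMr; apply: maximalMD => //; apply: maximalN.
- move=> x y _ _; exists ((x + y) / 2%:R * b); first exact: maximalM.
  by ring.
have s_root : a + 2%:R * s - s ^+ 2 * b = 0.
  by rewrite -{1}s_fix mulrC divrK //; ring.
exists s => //.
(* [- star s] is a root too, and the root in [r] is unique. *)
have star_root : a - 2%:R * star s - star s ^+ 2 * b = 0.
  have /(congr1 star) := s_root.
  rewrite rmorph0 rmorphB rmorphD !rmorphM rmorph_nat skew_a skew_b.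
  by move/(congr1 -%R); rewrite oppr0 => <-; ring.
(* The difference of the two root equations is [s + star s] times this element, so its invertibility
   forces [star s = - s]. *)
have U : 2%:R - (s - star s) * b \is a GRing.unit.
  rewrite -[X in X - _]mulr1 -[_ * b](mulVKr U2) -mulrBr unitrM U2 /=.
  by apply: unit_sub1; do 2!apply: maximalM.
apply/eqP; rewrite -addr_eq0; apply/eqP/(mulIr U); rewrite mul0r.
by rewrite -(subrr (0 : A)) -{1}s_root -star_root; ring.
Qed.

End CompleteLocal.

(** * Skew hermitian forms, submodules and symplectic planes *)

Section SkewHermitian.
Variables (A : comUnitRingType) (r : set A) (star : {rmorphism A -> A}).
Variables (V : lmodType A) (h : V -> V -> A).
Hypothesis r_local : local_with_maximal r.
Hypothesis r_complete : adic_complete r.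
Hypothesis U2 : (2%:R : A) \is a GRing.unit.
Hypothesis starK : involutive star.
Hypothesis ram : ramified r star.
Hypothesis h_skew : skew_hermitian_form star h.

Definition submodule (P : V -> Prop) : Prop :=
  P 0 /\ forall a x y, P x -> P y -> P (a *: x + y).

Lemma submodule_scale P a x : submodule P -> P x -> P (a *: x).
Proof. by move=> [P0 PD] Px; rewrite -[_ *: _]addr0; apply: PD. Qed.

Lemma submodule_sum P (K : finType) (Q : pred K) (c : K -> A) (e : K -> V) :
  submodule P -> (forall k, Q k -> P (e k)) -> P (\sum_(k | Q k) c k *: e k).
Proof.
move=> [P0 PD] Pe; elim/big_rec: _ => // k x Qk Px.
by apply: PD => //; apply: Pe.
Qed.

Lemma formC u v : h v u = - star (h u v). Proof. by case: h_skew. Qed.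

Lemma formDr u v v' : h u (v + v') = h u v + h u v'.
Proof. by case: h_skew. Qed.

Lemma formDl u u' v : h (u + u') v = h u v + h u' v.
Proof. by case: h_skew. Qed.

Lemma formZr a u v : h u (a *: v) = a * h u v. Proof. by case: h_skew. Qed.

Lemma formZl a u v : h (a *: u) v = star a * h u v.
Proof. by rewrite formC formZr rmorphM -mulrN -formC. Qed.

Lemma form0r u : h u 0 = 0. Proof. by rewrite -(scale0r 0) formZr mul0r. Qed.

Lemma form0l u : h 0 u = 0.
Proof. by rewrite -(scale0r 0) formZl rmorph0 mul0r. Qed.

Lemma form_sumr u (K : finType) (Q : pred K) (c : K -> A) (e : K -> V) :
  h u (\sum_(k | Q k) c k *: e k) = \sum_(k | Q k) c k * h u (e k).
Proof.
elim/big_rec2: _ => [|k x y _ <-]; first exact: form0r.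
by rewrite formDr formZr.
Qed.

Lemma form_eq0C u v : h u v = 0 -> h v u = 0.
Proof. by move=> uv0; rewrite formC uv0 rmorph0 oppr0. Qed.

Lemma form_self_skew u : star (h u u) = - h u u.
Proof. by rewrite {2}formC opprK. Qed.

Lemma submodule_orthogonal u : submodule (fun x => h u x = 0).
Proof.
split=> [|a x y ux uy]; first exact: form0r.
by rewrite formDr formZr ux uy mulr0 addr0.
Qed.

(** The clause on all submodules [P] says that the two pairs generate the same submodule; in this
    form it transports any property that defines a submodule. *)
Lemma symplectic_plane u v : h u v \is a GRing.unit ->
  exists u' v', symplectic_pair h u' v' /\
    forall P, submodule P -> P u /\ P v <-> P u' /\ P v'.
Proof.
move=> Uuv; have [v0 v0E] : exists v0, v0 = (h u v)^-1 *: v by eexists.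
have uv0 : h u v0 = 1 by rewrite v0E formZr mulVr.
have v0u : h v0 u = -1 by rewrite formC uv0 rmorph1.
have [s skew_s s_root] := skew_quadratic_root r_local r_complete U2 starK ram
  (form_self_skew u) (form_self_skew v0).
have [u' u'E] : exists u', u' = u + s *: v0 by eexists.
have uu' : h u' u' = 0.
  by rewrite u'E formDl !formDr !formZl !formZr uv0 v0u skew_s -[RHS]s_root; ring.
(* Moving [u] to [u'] changes the pairing with [v0] only by an element of [r], so [v0] can be
   rescaled. *)
have Uc : h u' v0 \is a GRing.unit.
  rewrite u'E formDl formZl uv0 skew_s mulNr; apply: (unit_sub1 r_local) => //.
  by apply: (maximalM r_local) => //; apply: ram; apply: form_self_skew.
have [v1 v1E] : exists v1, v1 = (h u' v0)^-1 *: v0 by eexists.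
have u'v1 : h u' v1 = 1 by rewrite v1E formZr mulVr.
have v1u' : h v1 u' = -1 by rewrite formC u'v1 rmorph1.
(* As [u'] is isotropic and [t] is skew, adding [t *: u'] to [v1] lowers [h v1 v1] by [2 t] and
   keeps the pairing with [u']. *)
have [t tE] : exists t, t = h v1 v1 / 2%:R by eexists.
have [v' v'E] : exists v', v' = v1 + t *: u' by eexists.
have skew_t : star t = - t.
  by rewrite tE rmorphM form_self_skew rmorphV // rmorph_nat mulNr.
exists u', v'; split.
  have u'v' : h u' v' = 1 by rewrite v'E formDr formZr uu' u'v1 mulr0 addr0.
  split=> //; last by rewrite formC u'v' rmorph1 opprK.
  rewrite v'E formDl !formDr !formZl !formZr uu' u'v1 v1u' skew_t.
  have -> : h v1 v1 = 2%:R * t by rewrite tE mulrC divrK.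
  by ring.
move=> P Psub; have [_ PD] := Psub.
have PDr a x y : P x -> P y -> P (x + a *: y).
  by move=> Px Py; rewrite addrC; apply: PD.
split=> [[Pu Pv]|[Pu' Pv']].
  have Pv0 : P v0 by rewrite v0E; apply: submodule_scale.
  have Pu' : P u' by rewrite u'E; apply: PDr.
  by split=> //; rewrite v'E v1E; apply: PDr => //; apply: submodule_scale.
have Pv0 : P v0.
  have -> : v0 = h u' v0 *: (v' + (- t) *: u').
    by rewrite scaleNr v'E addrK v1E scalerA divrr // scale1r.
  by apply: submodule_scale => //; apply: PDr.
split; last first.
  have -> : v = h u v *: v0 by rewrite v0E scalerA divrr // scale1r.
  exact: submodule_scale.
have -> : u = u' + (- s) *: v0 by rewrite scaleNr u'E addrK.
exact: PDr.
Qed.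

(** * Symplectic families and residual nondegeneracy *)

Definition symplectic_family l (v w : 'I_l -> V) : Prop :=
  (forall i, symplectic_pair h (v i) (w i)) /\
  forall i j, i != j ->
    [/\ h (v i) (v j) = 0, h (w i) (w j) = 0,
        h (v i) (w j) = 0 & h (w j) (v i) = 0].

Definition ord_cons l (x : V) (v : 'I_l -> V) (i : 'I_l.+1) : V :=
  oapp v x (unlift ord0 i).

Lemma ord_cons0 l x (v : 'I_l -> V) : ord_cons x v ord0 = x.
Proof. by rewrite /ord_cons unlift_none. Qed.

Lemma ord_consS l x (v : 'I_l -> V) i : ord_cons x v (lift ord0 i) = v i.
Proof. by rewrite /ord_cons liftK. Qed.

Lemma symplectic_family_cons x y l (v w : 'I_l -> V) :
  symplectic_pair h x y -> symplectic_family v w ->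
  (forall i, h x (v i) = 0 /\ h y (v i) = 0) ->
  (forall i, h x (w i) = 0 /\ h y (w i) = 0) ->
  symplectic_family (ord_cons x v) (ord_cons y w).
Proof.
move=> xy [vw_pair vw_orth] orth_v orth_w; split.
  by move=> i; case: (unliftP ord0 i) => [k|] ->; rewrite ?ord_consS ?ord_cons0.
move=> i j; case: (unliftP ord0 i) => [k|] ->; case: (unliftP ord0 j) => [k'|] ->;
  rewrite ?ord_consS ?ord_cons0 ?eqxx // => neq.
- by apply: vw_orth; apply: contra_neq neq => ->.
- have [xv yv] := orth_v k; have [xw yw] := orth_w k.
  by split=> //; apply: form_eq0C.
have [xv yv] := orth_v k'; have [xw yw] := orth_w k'.
by split=> //; apply: form_eq0C.
Qed.

(** The Gram matrix of the [e k] with [k] in [S] has trivial kernel modulo [r]. Subsets of a fixed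
    index type allow indices to be removed without renumbering. *)
Definition residually_nondegenerate (K : finType) (S : {set K}) (e : K -> V) :=
  forall c : K -> A,
    (forall k, k \in S -> r (h (e k) (\sum_(l in S) c l *: e l))) ->
    forall k, k \in S -> r (c k).

Lemma residually_nondegenerate_unit (K : finType) (S : {set K}) e i :
  residually_nondegenerate S e -> i \in S ->
  exists j, [/\ j \in S, j != i & h (e i) (e j) \is a GRing.unit].
Proof.
move=> nondeg Si; have [[j [Sj nr]]|all_r] :=
  pselect (exists j, j \in S /\ ~ r (h (e i) (e j))).
  exists j; split=> //; last exact: (unit_notin_maximal r_local).
  by apply/eqP => ji; apply: nr; rewrite ji; apply: ram; apply: form_self_skew.
case: (maximal1 r_local).
(* Take the indicator of [i] as coefficients: the combination is [e i], whose pairings would all lie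
   in [r], which forces 1 into [r]. *)
suff : r (i == i)%:R by rewrite eqxx.
apply: (nondeg (fun l => (l == i)%:R)) (Si) => k Sk.
rewrite (bigD1 i) //= eqxx scale1r big1 => [|l /andP[_ /negPf->]]; last first.
  by rewrite scale0r.
rewrite addr0 formC; apply: maximalN => //; apply: (ramified_maximal r_local starK ram).
by have [//|nr] := pselect (r (h (e i) (e k))); case: all_r; exists k.
Qed.

(** * Splitting off a plane, and the induction *)

Section SplitPlane.
Variables (K : finType) (S : {set K}) (e : K -> V) (i j : K) (u v : V).
Hypotheses (Si : i \in S) (Sj : j \in S) (ji : j != i).
Hypothesis uv_pair : symplectic_pair h u v.
Hypothesis uv_span : forall P, submodule P -> P (e i) /\ P (e j) <-> P u /\ P v.

(** The projection of [x] to the orthogonal complement of the plane of [u] and [v]. *)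
Definition plane_residue x : V := x + (h v x *: u + (- h u x) *: v).

Lemma plane_residue_orthogonal x :
  h u (plane_residue x) = 0 /\ h v (plane_residue x) = 0.
Proof.
have [uu vv uv vu] := uv_pair.
have vu' : h v u = -1 by rewrite -vu opprK.
by rewrite !formDr !formZr uu vv uv vu'; split; ring.
Qed.

(** A combination [x] of residues is a combination of the [e l] over [S] with the same coefficients
    away from [i] and [j]. It pairs into [r] with [e i] and [e j] because it is orthogonal to the
    plane, and with any other [e l] because [e l] and its residue pair alike with [x]. *)
Lemma residually_nondegenerate_split :
  residually_nondegenerate S e ->
  residually_nondegenerate (S :\ i :\ j) (plane_residue \o e).
Proof.
move=> nondeg c rc k Sk; set x := \sum_(l in _) _ in rc.
pose P y := exists p q, y = p *: e i + q *: e j.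
have Psub : submodule P.
  split=> [|a _ _ [p [q ->]] [p' [q' ->]]].
    by exists 0, 0; rewrite !scale0r addr0.
  exists (a * p + p'), (a * q + q').
  by rewrite !scalerDl scalerDr !scalerA addrACA.
have [Pu Pv] : P u /\ P v.
  apply/(uv_span Psub); split; [exists 1, 0 | exists 0, 1];
  by rewrite scale0r scale1r ?addr0 ?add0r.
have [p [q pqE]] : P (\sum_(l in S :\ i :\ j)
    c l *: (h v (e l) *: u + (- h u (e l)) *: v)).
  apply: submodule_sum => // l _; have [_ PD] := Psub.
  by apply: PD => //; apply: submodule_scale.
(* Here [p] and [q] collect the plane corrections of all residues, rewritten in terms of [e i] and
   [e j]. *)
pose c' l := if l == i then p else if l == j then q else c l.
have xE : x = \sum_(l in S) c' l *: e l.
  rewrite (big_setD1 i) //= (big_setD1 j) /=; last by rewrite !inE ji.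
  rewrite /c' !eqxx (negPf ji) addrA -pqE addrC -big_split /=.
  rewrite /x; apply: eq_bigr => l; rewrite !inE => /and3P[lj li _].
  by rewrite (negPf lj) (negPf li) /= scalerDr.
have orth_x : h u x = 0 /\ h v x = 0.
  by split; apply: submodule_sum (submodule_orthogonal _) _ => l _;
     case: (plane_residue_orthogonal (e l)).
(* Although [h] is only semilinear in its first variable, this is a submodule, so [uv_span] carries
   membership from [u], [v] to [e i], [e j]. *)
have Qsub : submodule (fun y => r (h y x)).
  split=> [|a y z ry rz]; first by rewrite form0l; apply: maximal0.
  by rewrite formDl formZl; apply: maximalMD.
have [Qi Qj] : r (h (e i) x) /\ r (h (e j) x).
  by apply/(uv_span Qsub); case: orth_x => -> ->; split; apply: maximal0.
move: (Sk); rewrite !inE => /and3P[kj ki Sk'].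
have <- : c' k = c k by rewrite /c' (negPf kj) (negPf ki).
apply: nondeg Sk' => l Sl; rewrite -xE.
have [->//|li] := eqVneq l i; have [->//|lj] := eqVneq l j.
have : r (h (plane_residue (e l)) x) by apply: rc; rewrite !inE lj li.
rewrite /plane_residue !formDl !formZl.
by case: orth_x => -> ->; rewrite !mulr0 !addr0.
Qed.

End SplitPlane.

(** Induction on a bound for the size of [S]: any [e i] has a partner [e j], their plane is split
    off, and the recursion treats the residues of the others. The clause on [P] says that the
    submodule generated does not change. *)
Lemma symplectic_family_exists n (K : finType) (S : {set K}) (e : K -> V) :
  (#|S| <= n)%N -> residually_nondegenerate S e ->
  exists l (v w : 'I_l -> V), symplectic_family v w /\
    forall P, submodule P ->
      (forall k, k \in S -> P (e k)) <-> (forall i, P (v i) /\ P (w i)).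
Proof.
elim: n S e => [|n IHn] S e leS nondeg;
  have [S0|[i Si]] := set_0Vmem S.
1,3: exists 0%N, (fun=> 0), (fun=> 0); split; first by split=> -[].
1,2: by move=> P _; split=> [_ []//|_ k]; rewrite S0 inE.
  by move: leS; rewrite leqn0 cards_eq0 => /eqP S0; rewrite S0 inE in Si.
have [j [Sj ji Uij]] := residually_nondegenerate_unit nondeg Si.
have [u [v [uv_pair uv_span]]] := symplectic_plane Uij.
have Sj' : j \in S :\ i by rewrite !inE ji.
have leS' : (#|S :\ i :\ j| <= n)%N.
  rewrite -ltnS (leq_trans _ leS) // (cardsD1 i S) Si (cardsD1 j (S :\ i)) Sj'.
  by rewrite ltnS add1n leqnSn.
have [l [v1 [w1 [fam span1]]]] := IHn _ _ leS'
  (residually_nondegenerate_split Si Sj ji uv_pair uv_span nondeg).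
exists l.+1, (ord_cons u v1), (ord_cons v w1); split.
  (* The vectors orthogonal to [x] form a submodule, so orthogonality passes from the residues to
     the family built from them. *)
  have orth x : (forall y, h x (plane_residue u v y) = 0) ->
      forall k, h x (v1 k) = 0 /\ h x (w1 k) = 0.
    by move=> hx; apply/(span1 _ (submodule_orthogonal x)) => k _; apply: hx.
  have orth_u := orth u (fun y => (plane_residue_orthogonal uv_pair y).1).
  have orth_v := orth v (fun y => (plane_residue_orthogonal uv_pair y).2).
  apply: symplectic_family_cons => // k;
  by split; [case: (orth_u k) | case: (orth_v k)].
move=> P Psub; have [P0 PD] := Psub.
(* A vector and its residue differ by an element of the plane, so they are interchangeable in
   submodules containing [u] and [v]. *)
have residueP x : P u -> P v -> P (plane_residue u v x) <-> P x.
  move=> Pu Pv; have Puv a b : P (a *: u + b *: v).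
    by apply: PD => //; apply: submodule_scale.
  rewrite /plane_residue; set y := (_ + _ *: v).
  have Py : P y by apply: Puv.
  split=> Px; last by rewrite addrC -[y]scale1r; apply: PD.
  by rewrite -[x](addrK y) addrC -scaleN1r; apply: PD.
split=> [Pe k|Pvw].
  have [Pu Pv] : P u /\ P v by apply/(uv_span P Psub); split; apply: Pe.
  have Pvw1 : forall k, P (v1 k) /\ P (w1 k).
    apply/(span1 P Psub) => k'; rewrite !inE => /and3P[_ _ Sk'].
    by apply/residueP => //; apply: Pe.
  by case: (unliftP ord0 k) => [k'|] ->; rewrite ?ord_consS ?ord_cons0.
have := Pvw ord0; rewrite !ord_cons0 => -[Pu Pv] k Sk.
have [Pi Pj] : P (e i) /\ P (e j) by apply/(uv_span P Psub).
have [->//|ki] := eqVneq k i; have [->//|kj] := eqVneq k j.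
apply/residueP => //; apply: (span1 P Psub).2; last by rewrite !inE kj ki.
by move=> k'; have := Pvw (lift ord0 k'); rewrite !ord_consS.
Qed.

(** The inverse Gram matrix recovers the coefficients as combinations of the pairings, which all lie
    in [r]. *)
Lemma gram_residually_nondegenerate n (e : 'I_n -> V) :
  gram h e \in unitmx -> residually_nondegenerate [set: 'I_n] e.
Proof.
move=> Ue c rc k _; pose C := \col_i c i.
have -> : c k = (invmx (gram h e) *m (gram h e *m C)) k ord0.
  by rewrite mulKmx // mxE.
rewrite mxE; apply: maximal_sum => // i _; apply: maximalM => //.
have := rc i (finset.in_setT i); congr r; rewrite mxE form_sumr.
by apply: eq_big => [l|l _]; rewrite ?inE // !mxE mulrC.
Qed.

(** Pairing the relation with the symplectic partner of the [k]-th vector kills every other term and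
    leaves [c k] up to sign. *)
Lemma symplectic_family_free l (v w : 'I_l -> V) (c : 'I_l + 'I_l -> A) :
  symplectic_family v w ->
  \sum_k c k *: (match k with inl i => v i | inr i => w i end) = 0 ->
  forall k, c k = 0.
Proof.
set b := fun k => match k with inl i => v i | inr i => w i end.
move=> [vw_pair vw_orth] c0 k.
have coef x : h x (b k) \is a GRing.unit ->
    (forall k', k' != k -> h x (b k') = 0) -> c k = 0.
  move=> Uxk x0; apply: (mulIr Uxk); rewrite mul0r -formZr.
  have /(congr1 (h x)) := c0; rewrite form0r (bigD1 k) //= formDr.
  move=> <-; rewrite [X in _ + X](_ : _ = 0) ?addr0 //.
  apply: submodule_sum (submodule_orthogonal x) _ => k' kk'; exact: x0.
have Upm (x : A) : x = 1 \/ - x = 1 -> x \is a GRing.unit.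
  by case=> [->|E]; [|rewrite -[x]opprK E unitrN]; rewrite unitr1.
case: k @b c0 coef => i b c0 coef; have [vv ww vw wv] := vw_pair i.
  apply: (coef (w i)) => [|[] j neq /=]; first by apply: Upm; right.
    by have /vw_orth[] : j != i by apply: contra_neq neq => ->.
  by have [<-//|/vw_orth[]] := eqVneq i j.
apply: (coef (v i)) => [|[] j neq /=]; first by apply: Upm; left.
  by have [<-//|/vw_orth[]] := eqVneq i j.
by have /vw_orth[] : i != j by apply: contra_neq neq => ->.
Qed.

End SkewHermitian.

(** * The symplectic basis of [V] *)

Theorem proposition1 (A : comUnitRingType) (r : set A)
    (star : {rmorphism A -> A}) (V : lmodType A) (m : nat) (h : V -> V -> A) :
  local_with_maximal r ->
  adic_complete r ->
  (2%:R : A) \is a GRing.unit ->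
  involutive star ->
  ramified r star ->
  (0 < m)%N ->
  free_of_rank V m ->
  skew_hermitian_form star h ->
  nondegenerate_form h ->
  exists (l : nat) (v w : 'I_l -> V), symplectic_basis h v w.
Proof.
move=> r_local r_complete U2 starK ram _ [e e_basis] h_skew nondeg.
have [l [v [w [fam span]]]] := symplectic_family_exists r_local r_complete U2
  starK ram h_skew (leqnn _)
  (gram_residually_nondegenerate r_local h_skew (nondeg _ _ e_basis)).
exists l, v, w; have [vw_pair vw_orth] := fam; split=> //.
split=> [x|]; last by move=> c; apply: (symplectic_family_free h_skew fam).
pose b (k : 'I_l + 'I_l) := match k with inl i => v i | inr i => w i end.
(* The span of the family: it contains every [v i] and [w i], hence by [span] every [e k], hence all
   of [V]. *)
pose P y := exists c : 'I_l + 'I_l -> A, y = \sum_k c k *: b k.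
have Psub : submodule P.
  split=> [|a _ _ [c ->] [c' ->]].
    by exists (fun=> 0); rewrite big1 // => k _; rewrite scale0r.
  exists (fun k => a * c k + c' k); rewrite scaler_sumr -big_split /=.
  by apply: eq_bigr => k _; rewrite scalerDl scalerA.
have Pb k : P (b k).
  exists (fun k' => (k' == k)%:R); rewrite (bigD1 k) //= eqxx scale1r.
  by rewrite big1 ?addr0 // => k' /negPf->; rewrite scale0r.
have [c ->] := e_basis.1 x; apply: (submodule_sum c Psub) => k _.
apply: (span _ Psub).2 (finset.in_setT k) => i.
by split; [apply: (Pb (inl i)) | apply: (Pb (inr i))].
Qed.
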